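(* Let $G$ be a matrix Lie group with a left action on $M$, and assume that on the domain $\mathcal U\subset M$ there is a (right) moving frame $\sigma:\mathcal U\to G$ for the action. Let $$[\Lambda]=\begin{pmatrix}0&\Phi\\-\Phi^T&\Lambda(\mathfrak g^* )\end{pmatrix}$$ be the structure matrix of the Poisson bracket defined by the group action, and let $H$ be a Hamiltonian function defined on $\mathcal U\times\mathfrak g^*$. Then in the frame adapted coordinates $z\mapsto(\sigma(z),\sigma(z)\cdot z)$ on $\mathcal U$, the Hamiltonian equations defined by $H$ and $[\Lambda]$ on the coordinates $(\sigma(z),\sigma(z)\cdot z)$ are $$\frac{d}{dt}\sigma(z)=-\sigma(z)\sum_i\frac{\partial H}{\partial\xi_i}v_i,\qquad\frac{d}{dt}\left(\sigma(z)\cdot z\right)=0.$$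
   Context: Let $\mathfrak g$ be the Lie algebra of $G$, with basis $v_1,\dots,v_r$ coming from coordinates on $G$ near the identity, and matrix commutator as bracket. A left action satisfies $h\cdot(g\cdot z)=(hg)\cdot z$. Everything is local: $M$ is an open subset of $\mathbb R^p$ with coordinates $z$. The matrix of infinitesimals is the $p\times r$ matrix with $\Phi_{\ell k}(z)=\frac{d}{dt}|_{t=0}(\exp(tv_k)\cdot z)^\ell$. The coordinates on $\mathfrak g^*$ are $\xi_i(\theta)=\theta(v_i)$, and $\Lambda(\mathfrak g^* )$ has entries $\sum_kc_{ij}^k\xi_k$, where $[v_i,v_j]=\sum_kc_{ij}^kv_k$. The Hamiltonian equations are $(\dot z,\dot\xi)^T=[\Lambda](\nabla_zH,\nabla_\xi H)^T$. A right moving frame on an open set $\mathcal U\subset M$ is a smooth map $\sigma:\mathcal U\to G$ with $\sigma(g\cdot z)=\sigma(z)g^{-1}$ (whenever $z,g\cdot z\in\mathcal U$). It is determined by a cross-section $\mathcal K$ transverse to the group orbits, via the condition $\sigma(z)\cdot z\in\mathcal K$ (the action on $\mathcal U$ being free and regular), and $z\mapsto(\sigma(z),\sigma(z)\cdot z)\in G\times\mathcal K$ gives local coordinates on $\mathcal U$. *)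

(* Defs.v *)
From HB Require Import structures.
From mathcomp Require Import all_boot all_order all_algebra.
From mathcomp Require Import all_classical all_reals.
From mathcomp Require Import topology normedtype sequences derive.

Set Implicit Arguments.
Unset Strict Implicit.
Unset Printing Implicit Defensive.

Import Order.TTheory GRing.Theory Num.Theory.
Import numFieldNormedType.Exports.

Local Open Scope classical_set_scope.
Local Open Scope ring_scope.

(* Points of R^p and R^r are column vectors. *)

Section Smooth.
Variables (R : realType) (V W : normedModType R).

(* C^oo on an open set A of a finite-dimensional space V: all iterated
   directional derivatives are (Frechet-)differentiable at the points of A. *)
Definition smooth (A : set V) (f : V -> W) : Prop :=
  forall vs : seq V, forall x, A x ->
    differentiable (foldr (fun v g => 'D_v g) f vs) x.

(* Smoothness on a set that need not be open, by local extension; on an embedded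
   submanifold of V this is smoothness in its manifold structure. *)
Definition smooth_within (A : set V) (f : V -> W) : Prop :=
  forall x, A x -> exists (O : set V) (g : V -> W),
    [/\ open O, O x, smooth O g & forall y, (A `&` O) y -> f y = g y].

End Smooth.

Section LieGroup.
Variables (R : realType) (n : nat).

Definition mexp (A : 'M[R]_n) : 'M[R]_n :=
  lim (series (fun k => (k`!%:R)^-1 *: A ^+ k) @ \oo).

(* The last field says that G is closed in GL_n(R). *)
Record matrix_lie_group (G : set 'M[R]_n) : Prop := MatrixLieGroup {
  mlg_unit : forall g, G g -> g \in unitmx;
  mlg1 : G 1%:M;
  mlgM : forall g h, G g -> G h -> G (g *m h);
  mlgV : forall g, G g -> G (invmx g);
  mlg_closed : forall g, closure G g -> g \in unitmx -> G g
}.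

Definition lie_algebra (G : set 'M[R]_n) : set 'M[R]_n :=
  [set x | forall t : R, G (mexp (t *: x))].

Definition lie_bracket (x y : 'M[R]_n) : 'M[R]_n := x *m y - y *m x.

Definition lie_basis (r : nat) (G : set 'M[R]_n) (v : r.-tuple 'M[R]_n) : Prop :=
  free v /\ forall x, lie_algebra G x <-> x \in <<v>>%VS.

Definition structure_constants (r : nat) (v : r.-tuple 'M[R]_n)
    (c : 'I_r -> 'I_r -> 'I_r -> R) : Prop :=
  forall i j : 'I_r, lie_bracket (tnth v i) (tnth v j) =
    \sum_(k < r) c i j k *: tnth v k.

End LieGroup.

Section Action.
Variables (R : realType) (n p : nat).

(* Left action of G on M, possibly only local: [act g z] is meaningful for (g, z)
   in the domain D, a relatively open neighbourhood of {1} x M in G x M.  A global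
   action is the case D = G `*` M. *)
Record left_action (G : set 'M[R]_n) (M : set 'cV[R]_p)
    (D : set ('M[R]_n * 'cV[R]_p)) (act : 'M[R]_n -> 'cV[R]_p -> 'cV[R]_p) : Prop :=
  LeftAction {
  act_dom : exists O : set ('M[R]_n * 'cV[R]_p), open O /\ D = (G `*` M) `&` O;
  act_dom1 : forall z, M z -> D (1%:M, z);
  act_in : forall g z, D (g, z) -> M (act g z);
  act_smooth : smooth_within D (fun gz => act gz.1 gz.2);
  act1 : forall z, M z -> act 1%:M z = z;
  actM : forall h g z, D (g, z) -> D (h, act g z) -> D (h *m g, z) ->
    act h (act g z) = act (h *m g) z;
  actV : forall g z, D (g, z) ->
    D (invmx g, act g z) /\ act (invmx g) (act g z) = z
}.

Record right_moving_frame (G : set 'M[R]_n) (D : set ('M[R]_n * 'cV[R]_p))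
    (act : 'M[R]_n -> 'cV[R]_p -> 'cV[R]_p) (U : set 'cV[R]_p)
    (sigma : 'cV[R]_p -> 'M[R]_n) : Prop := RightMovingFrame {
  frame_in : forall z, U z -> G (sigma z);
  frame_smooth : smooth U sigma;
  frame_dom : forall z, U z -> D (sigma z, z);
  frame_equiv : forall g z, U z -> D (g, z) -> U (act g z) ->
    sigma (act g z) = sigma z *m invmx g
}.

Variable r : nat.

Definition infinitesimals (act : 'M[R]_n -> 'cV[R]_p -> 'cV[R]_p)
    (v : r.-tuple 'M[R]_n) (z : 'cV[R]_p) : 'M[R]_(p, r) :=
  \matrix_(l < p, k < r)
    derive1 (fun t : R => act (mexp (t *: tnth v k)) z l ord0) 0.

(* A point theta of g^* is represented by its coordinates xi_i = theta(v_i). *)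
Definition lie_poisson_mx (c : 'I_r -> 'I_r -> 'I_r -> R) (xi : 'cV[R]_r) :
    'M[R]_r :=
  \matrix_(i < r, j < r) \sum_(k < r) c i j k * xi k ord0.

Definition poisson_mx (act : 'M[R]_n -> 'cV[R]_p -> 'cV[R]_p)
    (v : r.-tuple 'M[R]_n) (c : 'I_r -> 'I_r -> 'I_r -> R)
    (z : 'cV[R]_p) (xi : 'cV[R]_r) : 'M[R]_(p + r) :=
  block_mx 0 (infinitesimals act v z)
           (- (infinitesimals act v z)^T) (lie_poisson_mx c xi).

Definition grad (q : nat) (f : 'cV[R]_q -> R) (x : 'cV[R]_q) : 'cV[R]_q :=
  \col_(i < q) 'D_(delta_mx i ord0) f x.

Definition grad_z (H : 'cV[R]_p * 'cV[R]_r -> R) (z : 'cV[R]_p) (xi : 'cV[R]_r) :=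
  grad (fun z' => H (z', xi)) z.

Definition grad_xi (H : 'cV[R]_p * 'cV[R]_r -> R) (z : 'cV[R]_p) (xi : 'cV[R]_r) :=
  grad (fun xi' => H (z, xi')) xi.

Definition hamiltonian_equations (act : 'M[R]_n -> 'cV[R]_p -> 'cV[R]_p)
    (v : r.-tuple 'M[R]_n) (c : 'I_r -> 'I_r -> 'I_r -> R)
    (H : 'cV[R]_p * 'cV[R]_r -> R) (J : set R)
    (z : R -> 'cV[R]_p) (xi : R -> 'cV[R]_r) : Prop :=
  forall t, J t ->
    is_derive t 1 (fun s => col_mx (z s) (xi s))
      (poisson_mx act v c (z t) (xi t) *m
         col_mx (grad_z H (z t) (xi t)) (grad_xi H (z t) (xi t))).

(* The Hamiltonian system in the coordinates (sigma(z), sigma(z).z, xi): the last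
   equation is the xi-block of the system, which the change of coordinates
   on U leaves as it is. *)
Definition frame_adapted_equations (act : 'M[R]_n -> 'cV[R]_p -> 'cV[R]_p)
    (v : r.-tuple 'M[R]_n) (c : 'I_r -> 'I_r -> 'I_r -> R)
    (sigma : 'cV[R]_p -> 'M[R]_n)
    (H : 'cV[R]_p * 'cV[R]_r -> R) (J : set R)
    (z : R -> 'cV[R]_p) (xi : R -> 'cV[R]_r) : Prop :=
  forall t, J t ->
    [/\ is_derive t 1 (fun s => sigma (z s))
          (- (sigma (z t) *m
              \sum_(i < r) grad_xi H (z t) (xi t) i ord0 *: tnth v i)),
        is_derive t 1 (fun s => act (sigma (z s)) (z s)) 0 &
        is_derive t 1 xi
          (- (infinitesimals act v (z t))^T *m grad_z H (z t) (xi t)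
           + lie_poisson_mx c (xi t) *m grad_xi H (z t) (xi t))].

End Action.

(* Main.v *)
Require Import Defs.
From HB Require Import structures.
From mathcomp Require Import all_boot all_order all_algebra.
From mathcomp Require Import ring.
From mathcomp Require Import all_classical all_reals.
From mathcomp Require Import topology normedtype sequences derive exp.

Set Implicit Arguments.
Unset Strict Implicit.
Unset Printing Implicit Defensive.

Import Order.TTheory GRing.Theory Num.Theory.
Import numFieldNormedType.Exports.

Local Open Scope classical_set_scope.
Local Open Scope ring_scope.

(* Write z' = Phi(z) w for the z-block of the Hamiltonian system, w = grad_xi H.
   Differentiating sigma(exp(t v_k) . z) exp(t v_k) = sigma(z) at t = 0 gives
   d sigma(Phi_k) = - sigma(z) v_k, and the map z |-> sigma(z) . z is constant
   along t |-> exp(t v_k) . z, so its differential kills Phi_k.  The chain rule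
   gives the frame equations.  Conversely z = sigma(z)^-1 . (sigma(z) . z) is a
   differentiable function of the frame coordinates, so a curve z(t) solving the
   frame equations is differentiable; its velocity is determined by those of
   its frame coordinates, which are the same as for an affine curve with
   velocity Phi(z) w. *)

(** * Entrywise calculus for matrix-valued functions and curves *)

Section MatrixCalculus.
Variable R : realType.

Lemma cvg_mx_coord (T : Type) (F : set_system T) (FF : Filter F) m n
    (f : T -> 'M[R]_(m, n)) (l : 'M[R]_(m, n)) :
  (forall i j, f x i j @[x --> F] --> l i j) -> f x @[x --> F] --> l.
Proof.
move=> fl; rewrite [l]matrix_sum_delta.
rewrite (_ : (fun x => f x) = fun x => \sum_i \sum_j f x i j *: delta_mx i j);
  last by apply/funext => x; rewrite -matrix_sum_delta.
apply: cvg_big => [|i _]; first exact: add_continuous.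
apply: cvg_big => [|j _]; first exact: add_continuous.
by apply: cvgZr_tmp; exact: fl.
Qed.

Lemma differentiable_big (V W : normedModType R) (I : Type) (s : seq I)
    (P : pred I) (f : I -> V -> W) (x : V) :
  (forall i, P i -> differentiable (f i) x) ->
  differentiable (fun y => \sum_(i <- s | P i) f i y) x.
Proof.
move=> df; rewrite -[fun y => _]fct_sumE.
by elim/big_ind : _ => // g h dg dh; exact: differentiableD.
Qed.

Lemma differentiable_mx (V : normedModType R) m n (f : V -> 'M[R]_(m, n)) x :
  (forall i j, differentiable (fun y => f y i j) x) -> differentiable f x.
Proof.
move=> df; rewrite (_ : f = fun y => \sum_i \sum_j f y i j *: delta_mx i j);
  last by apply/funext => y; rewrite -matrix_sum_delta.
apply: differentiable_big => i _; apply: differentiable_big => j _.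
exact: differentiableZl.
Qed.

Lemma differentiable_det (V : normedModType R) n (f : V -> 'M[R]_n) x :
  (forall i j, differentiable (fun y => f y i j) x) ->
  differentiable (fun y => \det (f y)) x.
Proof.
move=> df; apply: differentiable_big => s _.
apply: differentiableM; first exact: differentiable_cst.
rewrite -[fun y => _]fct_prodE.
by elim/big_ind : _ => // g h dg dh; exact: differentiableM.
Qed.

(* [invmx] is this function on [unitmx] only. *)
Lemma differentiable_inv_det_adj n (A : 'M[R]_n) : A \in unitmx ->
  differentiable (fun B : 'M[R]_n => (\det B)^-1 *: \adj B : 'M[R]_n) A.
Proof.
rewrite unitmxE unitfE => detA0; apply: differentiable_mx => i j.
rewrite (_ : (fun B => _) =
  (fun B : 'M[R]_n => (\det B)^-1) * (fun B => cofactor B j i)); last first.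
  by apply/funext => B; rewrite !mxE.
apply: differentiableM.
  apply: differentiableV => //; apply: differentiable_det => k l.
  exact: differentiable_coord.
apply: differentiableM; first exact: differentiable_cst.
apply: differentiable_det => k l.
rewrite (_ : (fun B => _) = fun B : 'M[R]_n => B (lift j k) (lift i l)).
  exact: differentiable_coord.
by apply/funext => B; rewrite !mxE.
Qed.

(** Chain rule along a curve. The base point enters through an equation so that the lemma applies
    when [c t] simplifies only by rewriting, as with [exp(0 v_k) . z = z]. *)
Lemma is_derive_comp_diff (V W : normedModType R) (f : V -> W) (c : R -> V)
    (t : R) (x d : V) :
  c t = x -> is_derive t 1 c d -> differentiable f x ->
  is_derive t 1 (fun s => f (c s)) ('d f x d).
Proof.
move=> <- [dc <-] df; have dc' : differentiable c t by exact/derivable1_diffP.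
apply: DeriveDef.
  by apply/derivable1_diffP; exact: differentiable_comp.
rewrite !deriveE//; last exact: differentiable_comp.
by rewrite -/(f \o c) diff_comp.
Qed.

Lemma is_derive_unique (V : normedModType R) (f : R -> V) (t : R) d d' :
  is_derive t 1 f d -> is_derive t 1 f d' -> d = d'.
Proof. by move=> [_ <-] [_ <-]. Qed.

Lemma near_curve (V : normedModType R) (c : R -> V) (t : R) (d : V)
    (P : set V) :
  is_derive t 1 c d -> (\forall y \near c t, P y) -> \forall s \near t, P (c s).
Proof.
move=> [/derivable1_diffP /differentiable_continuous cc _] Pc.
exact: cc.
Qed.

Lemma is_derive_pair (V W : normedModType R) (a : R -> V) (b : R -> W) (t : R)
    da db :
  is_derive t 1 a da -> is_derive t 1 b db ->
  is_derive t 1 (fun s => (a s, b s)) (da, db).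
Proof.
move=> [/derivable1_diffP a' <-] [/derivable1_diffP b' <-].
apply: DeriveDef; first exact/derivable1_diffP/differentiable_pair.
by rewrite !deriveE ?diff_pair//; exact: differentiable_pair.
Qed.

Lemma is_derive_mx m n (f : R -> 'M[R]_(m, n)) (t : R) (d : 'M[R]_(m, n)) :
  is_derive t 1 f d <-> forall i j, is_derive t 1 (fun s => f s i j) (d i j).
Proof.
have coordP g (e : 'M[R]_(m, n)) i j : is_derive t 1 g e ->
    is_derive t 1 (fun s => g s i j) (e i j).
  move=> dg; have := is_derive_comp_diff erefl dg (differentiable_coord (g t) i j).
  have lf : linear (fun N : 'M[R]_(m, n) => N i j : R).
    by move=> a u v; rewrite !mxE.
  (* Packed as a linear map, the coordinate function is its own differential by [diff_lin]. *)
  pose fM := GRing.isLinear.Build _ _ _ _ _ lf.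
  pose fL : {linear _ -> _} := HB.pack (fun N : 'M[R]_(m, n) => N i j : R) fM.
  by rewrite -[fun N : 'M_(m, n) => N i j]/(fL : _ -> _) diff_lin//;
    exact: coord_continuous.
split=> [df i j|df]; first exact: coordP.
(* The entries give existence of the derivative first; its value is then read off entry by entry. *)
have /derivable1_diffP/derivableP df' : differentiable f t.
  apply: differentiable_mx => i j; apply/derivable1_diffP.
  by have [] := df i j.
suff <- : 'D_1 f t = d by [].
apply/matrixP => i j; have [_ <-] := coordP _ _ i j df'.
by have [_ <-] := df i j.
Qed.

Lemma is_derive_col_mx m1 m2 n (f : R -> 'M[R]_(m1, n)) (g : R -> 'M[R]_(m2, n))
    (t : R) df dg :
  is_derive t 1 (fun s => col_mx (f s) (g s)) (col_mx df dg) <->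
  is_derive t 1 f df /\ is_derive t 1 g dg.
Proof.
split=> [/is_derive_mx dfg|[/is_derive_mx dfP /is_derive_mx dgP]].
  split; apply/is_derive_mx => i j.
    have := dfg (lshift m2 i) j; rewrite col_mxEu.
    by under [fun s => col_mx _ _ _ _]eq_fun do rewrite col_mxEu.
  have := dfg (rshift m1 i) j; rewrite col_mxEd.
  by under [fun s => col_mx _ _ _ _]eq_fun do rewrite col_mxEd.
apply/is_derive_mx => i j; rewrite -[i]splitK; case: (fintype.split i) => k /=.
  by rewrite col_mxEu; under eq_fun do rewrite col_mxEu.
by rewrite col_mxEd; under eq_fun do rewrite col_mxEd.
Qed.

Lemma is_derive_mulmx m n p (f : R -> 'M[R]_(m, n)) (g : R -> 'M[R]_(n, p))
    (t : R) df dg :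
  is_derive t 1 f df -> is_derive t 1 g dg ->
  is_derive t 1 (fun s => f s *m g s) (df *m g t + f t *m dg).
Proof.
move=> /is_derive_mx dfP /is_derive_mx dgP; apply/is_derive_mx => i j.
rewrite (_ : (fun s => _) =
  \sum_k ((fun s => f s i k) * (fun s => g s k j))); last first.
  by rewrite fct_sumE; apply/funext => s; rewrite mxE.
apply: is_derive_eq.
rewrite !mxE -big_split /=; apply: eq_bigr => k _.
by rewrite addrC; congr (_ + _); rewrite mulrC.
Qed.

End MatrixCalculus.

(** * The matrix exponential and its derivative at 0 *)

Section MatrixExponential.
Variables (R : realType) (n : nat).

(** Comparison with [C] times the exponential series at [B * |x|]. *)
Lemma is_cvg_pseries_expR_le (a : R ^nat) (C B : R) (x : R) :
  (forall k, `|a k| <= C * B ^+ k) ->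
  cvgn (pseries (fun k => (k`!%:R)^-1 * a k) x).
Proof.
move=> aCB; apply: normed_cvg.
have le_ak k : `|(k`!%:R)^-1 * a k * x ^+ k| <= C * exp_coeff (B * `|x|) k.
  rewrite !normrM normrX normfV normr_nat /exp_coeff/= exprMn.
  have -> : C * (B ^+ k * `|x| ^+ k / k`!%:R) =
            (k`!%:R)^-1 * (C * B ^+ k) * `|x| ^+ k by ring.
  by rewrite ler_wpM2r ?exprn_ge0// ler_wpM2l// invr_ge0.
apply: (@series_le_cvg _ _ (C *: exp_coeff (B * `|x|))) => [k|k|k|].
- exact: normr_ge0.
- by apply: le_trans (normr_ge0 _) (le_ak k).
- exact: le_ak.
- by apply: is_cvg_seriesZ; exact: is_cvg_series_exp_coeff.
Qed.

(** Termwise differentiation: it shifts the coefficients [a k / k!] to [a k.+1 / k!], which satisfy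
    a bound of the same geometric form, so the first and second derived series converge as well. *)
Lemma is_derive_pseries_expR_le (a : R ^nat) (C B : R) :
  (forall k, `|a k| <= C * B ^+ k) ->
  is_derive (0 : R) 1 (fun x => limn (pseries (fun k => (k`!%:R)^-1 * a k) x))
    (a 1%N).
Proof.
move=> aCB.
have diffsE b : pseries_diffs (fun k => (k`!%:R)^-1 * b k) =
    (fun k => (k`!%:R)^-1 * b k.+1) :> (nat -> R).
  apply/funext => k; rewrite /pseries_diffs factS natrM invfM.
  by rewrite -!mulrA mulVKf// pnatr_eq0.
have aS (b : R ^nat) D : (forall k, `|b k| <= D * B ^+ k) ->
    forall k, `|b k.+1| <= D * B * B ^+ k.
  by move=> bD k; rewrite -mulrA -exprS.
have -> : a 1%N = limn (pseries (pseries_diffs (fun k => (k`!%:R)^-1 * a k)) 0).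
  (* At 0 every nonempty partial sum reduces to its term of index 0, since [0 ^+ 0 = 1]. *)
  apply/esym; apply: lim_near_cst => //; rewrite diffsE; near=> m.
  rewrite /pseries /series/= -[m]prednK; last by near: m; exists 1%N.
  rewrite big_nat_recl//= fact0 invr1 mul1r expr0 mulr1 big1_seq ?addr0// => i _.
  by rewrite expr0n mulr0.
(* Convergence is checked at the radius 1; any nonzero radius contains the point 0 in its
   interior. *)
apply: (@pseries_snd_diffs _ _ 1).
- exact: is_cvg_pseries_expR_le aCB.
- by rewrite diffsE; apply: is_cvg_pseries_expR_le; exact: aS aCB.
- by rewrite !diffsE; apply: is_cvg_pseries_expR_le; exact: aS (aS _ _ aCB).
- by rewrite normr0 normr1.
Unshelve. all: by end_near. Qed.

Lemma exprmx_coord_le (A : 'M[R]_n) k i j :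
  `|(A ^+ k) i j| <= (\sum_i \sum_j `|A i j|) ^+ k.
Proof.
elim: k i => [|k IH] i.
  by rewrite !expr0 !mxE; case: (i == j); rewrite ?normr1 ?normr0.
rewrite exprS mxE (le_trans (ler_norm_sum _ _ _))//.
(* Only row [i] of the total sum is needed to bound the product; the other rows are nonnegative. *)
rewrite exprS [X in _ <= X * _](bigD1 i)//= mulrDl.
rewrite ler_wpDr//.
  by rewrite mulr_ge0 ?exprn_ge0//; do 2?apply: sumr_ge0 => ? _ //;
    apply: sumr_ge0.
rewrite mulr_suml; apply: ler_sum => l _.
by rewrite normrM ler_wpM2l.
Qed.

Lemma exprmxZ (t : R) (A : 'M[R]_n) k : (t *: A) ^+ k = t ^+ k *: A ^+ k.
Proof.
elim: k => [|k IH]; first by rewrite !expr0 scale1r.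
by rewrite !exprS IH -[LHS]scalemxAl -scalemxAr scalerA.
Qed.

(** Reduces [mexp] to scalar power series in [t]. Entrywise convergence also shows that the [lim]
    defining [mexp] is a genuine limit. *)
Lemma mexp_coord (A : 'M[R]_n) (t : R) i j :
  mexp (t *: A) i j = limn (pseries (fun k => (k`!%:R)^-1 * (A ^+ k) i j) t).
Proof.
pose S : 'M[R]_n := \matrix_(i, j)
  limn (pseries (fun k => (k`!%:R)^-1 * (A ^+ k) i j) t).
suff -> : mexp (t *: A) = S by rewrite mxE.
apply: cvg_lim => //; apply: cvg_mx_coord => k l; rewrite mxE.
rewrite (_ : (fun x => _) = pseries (fun m => (m`!%:R)^-1 * (A ^+ m) k l) t).
  apply: (is_cvg_pseries_expR_le (C := 1)) => m.
  by rewrite mul1r; exact: exprmx_coord_le.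
apply/funext => m; rewrite /pseries /series/= summxE; apply: eq_bigr => q _.
by rewrite exprmxZ !mxE; ring.
Qed.

Lemma is_derive_mexp (A : 'M[R]_n) :
  is_derive (0 : R) 1 (fun t => mexp (t *: A)) A.
Proof.
apply/is_derive_mx => i j.
rewrite (_ : (fun s => _) =
  fun t => limn (pseries (fun k => (k`!%:R)^-1 * (A ^+ k) i j) t)); last first.
  by apply/funext => t; rewrite mexp_coord.
have -> : A i j = (A ^+ 1) i j by rewrite expr1.
apply: (is_derive_pseries_expR_le (C := 1)) => k.
by rewrite mul1r; exact: exprmx_coord_le.
Qed.

Lemma mexp0 : mexp (0 : 'M[R]_n) = 1%:M.
Proof.
apply: lim_near_cst => //; near=> m.
rewrite /series/= -[m]prednK; last by near: m; exists 1%N.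
rewrite big_nat_recl//= fact0 invr1 scale1r expr0 big1_seq ?addr0// => k _.
by rewrite expr0n scaler0.
Unshelve. all: by end_near. Qed.

End MatrixExponential.

Lemma mulmx_cV_sum_col (R : comPzRingType) m n (A : 'M[R]_(m, n)) (w : 'cV_n) :
  A *m w = \sum_j w j ord0 *: col j A.
Proof.
by apply/colP => i; rewrite !(mxE, summxE); apply: eq_bigr => j _;
   rewrite !mxE mulrC.
Qed.

(** * Differentiating a local action through ambient extensions *)

Section LocalAction.
Variables (R : realType) (n p r : nat) (G : set 'M[R]_n) (M : set 'cV[R]_p).
Variables (D : set ('M[R]_n * 'cV[R]_p)) (act : 'M[R]_n -> 'cV[R]_p -> 'cV[R]_p).
Hypotheses (hG : matrix_lie_group G) (hact : left_action G M D act).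

(** [G] need not be open among matrices, so [act] has no usable differential in the ambient space;
    [e] supplies one. The second clause also records that [D] is relatively open in [G x M]. *)
Definition extends_act (e : 'M[R]_n * 'cV[R]_p -> 'cV[R]_p)
    (gz : 'M[R]_n * 'cV[R]_p) :=
  differentiable e gz /\
  \forall y \near gz, G y.1 -> M y.2 -> D y /\ act y.1 y.2 = e y.

Lemma exists_extends_act g z : D (g, z) -> exists e, extends_act e (g, z).
Proof.
move=> Dgz; have [O' [oO' DE]] := act_dom hact.
have [O [e [oO Ogz se eE]]] := act_smooth hact Dgz.
(* The empty list of directions in [smooth] gives differentiability of [e] itself. *)
exists e; split; first exact: (se [::]).
have O'gz : O' (g, z) by move: Dgz; rewrite DE => -[].
have nO := open_nbhs_nbhs (conj oO Ogz).
have nO' := open_nbhs_nbhs (conj oO' O'gz).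
near=> y => Gy My; have Oy : O y by near: y.
have Dy : D y by rewrite DE; split=> //; near: y.
by split=> //; exact: eE.
Unshelve. all: by end_near. Qed.

Lemma near_act_dom (a : R -> 'M[R]_n) (b : R -> 'cV[R]_p) (t : R) da db :
  is_derive t 1 a da -> is_derive t 1 b db -> D (a t, b t) ->
  (\forall s \near t, G (a s) /\ M (b s)) -> \forall s \near t, D (a s, b s).
Proof.
move=> a' b' /exists_extends_act[e [_ eE]] GM.
have := near_curve (is_derive_pair a' b') eE.
by apply: filterS2 GM => s [Ga Mb] /(_ Ga Mb)[].
Qed.

(** A curve staying in [G x M] sees no difference between [act] and [e], so the chain rule for [e]
    applies. *)
Lemma is_derive_act (e : 'M[R]_n * 'cV[R]_p -> 'cV[R]_p)
    (a : R -> 'M[R]_n) (b : R -> 'cV[R]_p) (t : R) g z da db :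
  a t = g -> b t = z -> extends_act e (g, z) ->
  is_derive t 1 a da -> is_derive t 1 b db ->
  (\forall s \near t, G (a s) /\ M (b s)) ->
  is_derive t 1 (fun s => act (a s) (b s)) ('d e (g, z) (da, db)).
Proof.
move=> <- <- [de eE] a' b' GM; have ab' := is_derive_pair a' b'.
apply: near_eq_is_derive (is_derive_comp_diff erefl ab' de).
have := near_curve ab' eE.
by apply: filterS2 GM => s [Ga Mb] /(_ Ga Mb)[_ <-].
Qed.

(** * Infinitesimals as velocities of one-parameter orbits *)

Section Infinitesimals.
Variable v : r.-tuple 'M[R]_n.
Hypothesis hv : lie_basis G v.

Lemma mexp_basis_in k t : G (mexp (t *: tnth v k)).
Proof.
have [_ /(_ (tnth v k))[_]] := hv; apply.
by apply: memv_span; exact: mem_tnth.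
Qed.

Lemma near_orbit_dom z k : M z ->
  \forall t \near (0 : R), D (mexp (t *: tnth v k), z).
Proof.
move=> Mz; apply: near_act_dom (is_derive_mexp (tnth v k)) (is_derive_cst z _ _) _ _.
  by rewrite scale0r mexp0; exact: (act_dom1 hact).
by near=> t; split=> //; exact: mexp_basis_in.
Unshelve. all: by end_near. Qed.

(** [derive1] has a value even where no derivative exists; this shows that the columns of
    [infinitesimals] are true derivatives. *)
Lemma is_derive_orbit z k : M z ->
  is_derive (0 : R) 1 (fun t => act (mexp (t *: tnth v k)) z)
    (col k (infinitesimals act v z)).
Proof.
move=> Mz; have [e ext] := exists_extends_act (act_dom1 hact Mz).
have g0 : mexp (0 *: tnth v k) = 1%:M by rewrite scale0r mexp0.
have GM : \forall t \near (0 : R), G (mexp (t *: tnth v k)) /\ M z.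
  by near=> t; split=> //; exact: mexp_basis_in.
have d' := is_derive_act g0 erefl ext (is_derive_mexp (tnth v k))
  (is_derive_cst z _ _) GM.
apply: (is_derive_eq d').
apply/matrixP => i j; rewrite !mxE ord1 derive1E.
by have /is_derive_mx/(_ i ord0)[_ ->] := d'.
Unshelve. all: by end_near. Qed.

(** * Differentials of the frame and of the cross-section component *)

Section Frame.
Variables (U : set 'cV[R]_p) (sigma : 'cV[R]_p -> 'M[R]_n).
Hypotheses (hU : open U) (hUM : U `<=` M).
Hypothesis hsigma : right_moving_frame G D act U sigma.

Lemma differentiable_frame z : U z -> differentiable sigma z.
Proof. exact: (frame_smooth hsigma [::]). Qed.

Lemma orbit0 z k : U z -> act (mexp (0 *: tnth v k)) z = z.
Proof. by move=> Uz; rewrite scale0r mexp0 (act1 hact)//; exact: hUM. Qed.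

Lemma near_orbit_frame z k : U z -> \forall t \near (0 : R),
  D (mexp (t *: tnth v k), z) /\ U (act (mexp (t *: tnth v k)) z).
Proof.
move=> Uz; near=> t; split.
  by near: t; apply: near_orbit_dom; exact: hUM.
near: t; apply: near_curve (is_derive_orbit k (hUM Uz)) _.
by apply: open_nbhs_nbhs; rewrite orbit0.
Unshelve. all: by end_near. Qed.

Lemma is_derive_frame_orbit z k : U z ->
  is_derive (0 : R) 1 (fun t => sigma (act (mexp (t *: tnth v k)) z))
    ('d sigma z (col k (infinitesimals act v z))).
Proof.
move=> Uz; apply: is_derive_comp_diff (orbit0 k Uz) (is_derive_orbit k (hUM Uz)) _.
exact: differentiable_frame.
Qed.

(* Differentiate [sigma (exp (t v_k) . z) exp (t v_k) = sigma z] at [t = 0]. *)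
Lemma diff_frame_col z k : U z ->
  'd sigma z (col k (infinitesimals act v z)) = - (sigma z *m tnth v k).
Proof.
move=> Uz.
have := is_derive_mulmx (is_derive_frame_orbit k Uz) (is_derive_mexp (tnth v k)).
rewrite (orbit0 k Uz) scale0r mexp0 mulmx1 => d'.
apply/eqP; rewrite -addr_eq0; apply/eqP.
apply: is_derive_unique d' _; apply: near_eq_is_derive (is_derive_cst (sigma z) _ _).
near=> t.
have [Dt Ut] : D (mexp (t *: tnth v k), z) /\ U (act (mexp (t *: tnth v k)) z).
  by near: t; exact: near_orbit_frame.
rewrite (frame_equiv hsigma)// mulmxKV//.
by apply: (mlg_unit hG); exact: mexp_basis_in.
Unshelve. all: by end_near. Qed.

Lemma diff_frame z (w : 'cV[R]_r) : U z ->
  'd sigma z (infinitesimals act v z *m w) =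
  - (sigma z *m \sum_(i < r) w i ord0 *: tnth v i).
Proof.
move=> Uz; rewrite mulmx_cV_sum_col linear_sum mulmx_sumr -sumrN.
apply: eq_bigr => i _.
by rewrite linearZ/= diff_frame_col// scalerN scalemxAr.
Qed.

(* [sigma (exp (t v_k) . z) . (exp (t v_k) . z)] does not depend on [t], and
   [e] extends the action to an open set, where it can be differentiated. *)
Lemma diff_cross_section_col z e k : U z -> extends_act e (sigma z, z) ->
  'd e (sigma z, z) ('d sigma z (col k (infinitesimals act v z)),
                     col k (infinitesimals act v z)) = 0.
Proof.
move=> Uz ext; set y := fun t : R => act (mexp (t *: tnth v k)) z.
have y0 : y 0 = z by exact: orbit0.
have s0 : sigma (y 0) = sigma z by rewrite y0.
have GM : \forall t \near (0 : R), G (sigma (y t)) /\ M (y t).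
  near=> t; have [_ Ut] : D (mexp (t *: tnth v k), z) /\ U (y t).
    by near: t; exact: near_orbit_frame.
  by split; [exact: (frame_in hsigma)|exact: hUM].
have d' := is_derive_act s0 y0 ext (is_derive_frame_orbit k Uz)
  (is_derive_orbit k (hUM Uz)) GM.
apply: is_derive_unique d' _.
apply: near_eq_is_derive (is_derive_cst (act (sigma z) z) _ _).
near=> t.
have [Dt Ut] : D (mexp (t *: tnth v k), z) /\ U (y t).
  by near: t; exact: near_orbit_frame.
have sE : sigma (y t) *m mexp (t *: tnth v k) = sigma z.
  rewrite /y (frame_equiv hsigma)// mulmxKV//.
  by apply: (mlg_unit hG); exact: mexp_basis_in.
rewrite -[RHS]/(act (sigma (y t)) (act (mexp (t *: tnth v k)) z)).
rewrite (actM hact) ?sE//; exact: (frame_dom hsigma).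
Unshelve. all: by end_near. Qed.

Lemma diff_cross_section z e (w : 'cV[R]_r) : U z ->
  extends_act e (sigma z, z) ->
  'd e (sigma z, z) ('d sigma z (infinitesimals act v z *m w),
                     infinitesimals act v z *m w) = 0.
Proof.
move=> Uz ext; rewrite mulmx_cV_sum_col.
(* [dF] is the differential of [x |-> sigma x . x] at [z]. It is linear and kills each column of the
   infinitesimals, hence their combinations. *)
pose dF u := 'd e (sigma z, z) ('d sigma z u, u).
rewrite -/(dF _); elim/big_rec : _ => [|i u _ dFu]; rewrite /dF linearE.
  exact: (linear0 ('d e (sigma z, z))).
rewrite linearZ/=.
have -> : (w i ord0 *: 'd sigma z (col i (infinitesimals act v z)) +
    'd sigma z u, w i ord0 *: col i (infinitesimals act v z) + u) =
  w i ord0 *: ('d sigma z (col i (infinitesimals act v z)),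
               col i (infinitesimals act v z)) + ('d sigma z u, u) by [].
rewrite (linearP ('d e (sigma z, z))) -/(dF u) dFu addr0.
by rewrite diff_cross_section_col//; exact: scaler0.
Qed.

(** * The change of coordinates along curves *)

Lemma is_derive_frame_coordinates (y : R -> 'cV[R]_p) (t : R) d :
  (\forall s \near t, U (y s)) -> is_derive t 1 y d ->
  is_derive t 1 (fun s => sigma (y s)) ('d sigma (y t) d) /\
  forall e, extends_act e (sigma (y t), y t) ->
  is_derive t 1 (fun s => act (sigma (y s)) (y s))
    ('d e (sigma (y t), y t) ('d sigma (y t) d, d)).
Proof.
move=> Uy y'; have Ut := nbhs_singleton Uy.
have s' := is_derive_comp_diff erefl y' (differentiable_frame Ut).
split=> // e ext; apply: (is_derive_act erefl erefl ext s' y').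
apply: filterS Uy => s Us.
by split; [exact: (frame_in hsigma)|exact: hUM].
Qed.

(* [L] is the differential of the left inverse [(g, x) |-> g^-1 . x] of
   [x |-> (sigma x, sigma x . x)]; the curve [y] is not assumed differentiable. *)
Lemma frame_coordinates_inverse z : U z ->
  exists L : 'M[R]_n -> 'cV[R]_p -> 'cV[R]_p, forall (y : R -> 'cV[R]_p) (t : R) S b,
    y t = z -> (\forall s \near t, U (y s)) ->
    is_derive t 1 (fun s => sigma (y s)) S ->
    is_derive t 1 (fun s => act (sigma (y s)) (y s)) b ->
    is_derive t 1 y (L S b).
Proof.
move=> Uz; have Ds := frame_dom hsigma Uz.
have [/exists_extends_act[e ext] _] := actV hact Ds.
have unit_frame x : U x -> sigma x \in unitmx.
  by move=> Ux; apply: (mlg_unit hG); exact: (frame_in hsigma).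
pose inv (B : 'M[R]_n) : 'M[R]_n := (\det B)^-1 *: \adj B.
have invE B : B \in unitmx -> inv B = invmx B by rewrite /inv /invmx => ->.
exists (fun S b => 'd e (invmx (sigma z), act (sigma z) z) ('d inv (sigma z) S, b)).
move=> y t S b yt Uy s' b'; have Ut := nbhs_singleton Uy.
have at_t : inv (sigma (y t)) = invmx (sigma z).
  by rewrite yt; apply: invE; exact: unit_frame.
have bt : act (sigma (y t)) (y t) = act (sigma z) z by rewrite yt.
have st : sigma (y t) = sigma z by rewrite yt.
have i' := is_derive_comp_diff st s' (differentiable_inv_det_adj (unit_frame _ Uz)).
have GM : \forall s \near t, G (inv (sigma (y s))) /\ M (act (sigma (y s)) (y s)).
  apply: filterS Uy => s Us; rewrite invE; last exact: unit_frame.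
  split; first by apply: (mlgV hG); exact: (frame_in hsigma).
  by apply: (act_in hact); exact: (frame_dom hsigma).
have := is_derive_act at_t bt ext i' b' GM; apply: near_eq_is_derive.
apply: filterS Uy => s Us.
rewrite -/(inv _) invE; last exact: unit_frame.
by have [] := actV hact (frame_dom hsigma Us).
Qed.

(** The [z]-block of the equivalence, for an arbitrary vector [w]. The converse uses that the frame
    velocities determine the velocity of the curve through [L]. *)
Lemma frame_adapted_velocity (y : R -> 'cV[R]_p) (t : R) (w : 'cV[R]_r) :
  (\forall s \near t, U (y s)) ->
  is_derive t 1 y (infinitesimals act v (y t) *m w) <->
  is_derive t 1 (fun s => sigma (y s))
    (- (sigma (y t) *m \sum_(i < r) w i ord0 *: tnth v i)) /\
  is_derive t 1 (fun s => act (sigma (y s)) (y s)) 0.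
Proof.
move=> Uy; have Ut := nbhs_singleton Uy.
have [e ext] := exists_extends_act (frame_dom hsigma Ut).
set u := _ *m w.
(* Stated for any curve through [y t], since it serves both [y] and the affine curve below. *)
have coordP c : c t = y t -> (\forall s \near t, U (c s)) ->
    is_derive t 1 c u ->
    is_derive t 1 (fun s => sigma (c s))
      (- (sigma (y t) *m \sum_(i < r) w i ord0 *: tnth v i)) /\
    is_derive t 1 (fun s => act (sigma (c s)) (c s)) 0.
  move=> ct Uc c'; have [s' f'] := is_derive_frame_coordinates Uc c'.
  rewrite -(diff_frame w Ut) -(diff_cross_section w Ut ext) -/u -ct.
  by split=> //; apply: f'; rewrite ct.
split=> [|[s' f']]; first exact: coordP.
have [L LP] := frame_coordinates_inverse Ut.
have y' := LP y t _ _ erefl Uy s' f'.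
(* A comparison curve with velocity [u] by construction; by [coordP] its frame velocities are those
   assumed of [y]. *)
pose c (s : R) := y t + (s - t) *: u.
have ct : c t = y t by rewrite /c subrr scale0r addr0.
have c' : is_derive t 1 c u.
  apply/is_derive_mx => i j; rewrite (_ : (fun s => _) =
    cst (y t i j) + u i j *: (id - cst t)); last first.
    by apply/funext => s; rewrite /c !mxE mulrC.
  by apply: is_derive_eq; rewrite subr0 add0r [LHS]mulr1.
have Uc : \forall s \near t, U (c s).
  by apply: near_curve c' _; rewrite ct; exact: open_nbhs_nbhs.
have [cs cf] := coordP c ct Uc c'.
(* [L] sends the common frame velocities to [u] along [c], hence also along [y]. *)
by rewrite (is_derive_unique c' (LP c t _ _ ct Uc cs cf)).
Qed.

End Frame.
End Infinitesimals.
End LocalAction.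

Theorem proposition3p9 (R : realType) (n p r : nat)
  (G : set 'M[R]_n) (hG : matrix_lie_group G)
  (v : r.-tuple 'M[R]_n) (hv : lie_basis G v)
  (c : 'I_r -> 'I_r -> 'I_r -> R) (hc : structure_constants v c)
  (M : set 'cV[R]_p) (hM : open M)
  (D : set ('M[R]_n * 'cV[R]_p)) (act : 'M[R]_n -> 'cV[R]_p -> 'cV[R]_p)
  (hact : left_action G M D act)
  (U : set 'cV[R]_p) (hU : open U) (hUM : U `<=` M)
  (sigma : 'cV[R]_p -> 'M[R]_n) (hsigma : right_moving_frame G D act U sigma)
  (H : 'cV[R]_p * 'cV[R]_r -> R) (hH : smooth (U `*` setT) H)
  (J : set R) (hJ : open J)
  (z : R -> 'cV[R]_p) (xi : R -> 'cV[R]_r) (hz : forall t, J t -> U (z t)) :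
  hamiltonian_equations act v c H J z xi <->
  frame_adapted_equations act v c sigma H J z xi.
Proof.
(* Openness of [J] keeps the curve in [U] for all times near [t], as derivatives at [t] require. *)
have Uz t : J t -> \forall s \near t, U (z s).
  by move=> Jt; apply: filterS (open_nbhs_nbhs (conj hJ Jt)); exact: hz.
have velocityP t (Jt : J t) := frame_adapted_velocity hG hact hv hU hUM hsigma
  (grad_xi H (z t) (xi t)) (Uz t Jt).
rewrite /hamiltonian_equations /poisson_mx.
(* The zero block leaves [Phi(z) grad_xi H] as the velocity of [z]; the [xi]-block is already that
   of the frame system. *)
under eq_forall do rewrite mul_block_col mul0mx add0r.
split=> eqs t Jt; have := eqs t Jt.
  by case/is_derive_col_mx => /(velocityP _ Jt)[].
by move=> [s' f' x']; apply/is_derive_col_mx; split=> //; exact/velocityP.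
Qed.
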